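(* Let $t\in\{\circ|,\ \circ+,\ |\circ,\ +\circ,\ *\circ\}$. Given a homogeneous regular expression $\mathcal{A}$ of type $*\circ$ of size $m$ and a homogeneous regular expression $\mathcal{B}$ of type $t$ of size $n$, one can decide whether $\mathcal{L}(\mathcal{A})\cap\mathcal{L}(\mathcal{B})\neq\emptyset$ in $\mathcal{O}(m+n)$ time.
   Context: Regular expressions are over an integer alphabet $\Sigma$ of size polynomial in the input size, viewed as rooted trees with letters at leaves; the size is the number of leaves. A homogeneous regexp of type $t_1t_2$ has root labelled $t_1$, all depth-1 inner nodes labelled $t_2$, whose children are leaves (children of the root may also be leaves). Type $*\circ$: $[T]^*$ for a nonempty string $T$, language $\{T^k:k\ge0\}$; type $+\circ$: $[T]^+$, language $\{T^k:k\ge1\}$; type $|\circ$: a union $[T_1|\cdots|T_h]$ of nonempty strings; type $\circ|$: a concatenation of symbols each a letter or a union of letters; type $\circ+$: a concatenation of symbols $c$ or $c^+$ ($c\in\Sigma$). *)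

(* Defs.v *)
From HB Require Import structures.
From mathcomp Require Import all_boot.

Set Implicit Arguments.
Unset Strict Implicit.
Unset Printing Implicit Defensive.

Inductive regex : Type :=
| RLeaf of nat
| RCat of seq regex
| RAlt of seq regex
| RPlus of regex
| RStar of regex.

Inductive rop : Type := OCat | OAlt | OPlus | OStar.

(* Nonzero, so that 0 can mark leaves in [encode]. *)
Definition rop_code (o : rop) : nat :=
  match o with OCat => 1 | OAlt => 2 | OPlus => 3 | OStar => 4 end.

Lemma rop_code_inj : injective rop_code.
Proof. by case=> [] []. Qed.

HB.instance Definition _ := Equality.copy rop (inj_type rop_code_inj).

Definition label (r : regex) : option rop :=
  match r with
  | RLeaf _ => None
  | RCat _ => Some OCat
  | RAlt _ => Some OAlt
  | RPlus _ => Some OPlus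
  | RStar _ => Some OStar
  end.

Definition children (r : regex) : seq regex :=
  match r with
  | RLeaf _ => [::]
  | RCat l | RAlt l => l
  | RPlus r1 | RStar r1 => [:: r1]
  end.

Fixpoint leaves (r : regex) : seq nat :=
  match r with
  | RLeaf c => [:: c]
  | RCat l | RAlt l => flatten (map leaves l)
  | RPlus r1 | RStar r1 => leaves r1
  end.

Definition rsize (r : regex) : nat := size (leaves r).

Definition is_leaf (r : regex) : bool := label r == None.

(* The inductive type allows [RCat [::]] and [RAlt [::]], which are childless
   nodes carrying no letter; in an expression tree only leaves are childless. *)
Definition inner_node (o : rop) (r : regex) : bool :=
  (label r == Some o) && ~~ nilp (children r).

(* [(t1, t2)] stands for the type [t1 t2]. *)
Definition homogeneous (t : rop * rop) (r : regex) : bool :=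
  inner_node t.1 r &&
  all (fun r1 => is_leaf r1 || inner_node t.2 r1 && all is_leaf (children r1))
      (children r).

Definition language := seq nat -> Prop.

Definition leps : language := fun s => s = [::].
Definition lempty : language := fun _ => False.
Definition lcat (L1 L2 : language) : language :=
  fun s => exists s1 s2, s = s1 ++ s2 /\ L1 s1 /\ L2 s2.
Definition lalt (L1 L2 : language) : language := fun s => L1 s \/ L2 s.
Definition lpow (L : language) (k : nat) : language := iter k (lcat L) leps.

Fixpoint lang (r : regex) : language :=
  match r with
  | RLeaf c => fun s => s = [:: c]
  | RCat l => foldr lcat leps (map lang l)
  | RAlt l => foldr lalt lempty (map lang l)
  | RPlus r1 => fun s => exists2 k, 0 < k & lpow (lang r1) k s
  | RStar r1 => fun s => exists k, lpow (lang r1) k s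
  end.

(* Word RAM: registers and memory cells hold [w]-bit words, that is, naturals below
   [2 ^ w]; every instruction takes one unit of time. *)

Inductive binop : Type :=
| BAdd | BSub | BMul | BDiv | BMod | BAnd | BOr | BXor | BShl | BShr.

(* Results are reduced modulo [2 ^ w]; division by 0 returns 0, and the
   remainder modulo 0 is the dividend. *)
Definition eval_binop (w : nat) (o : binop) (x y : nat) : nat :=
  match o with
  | BAdd => x + y
  | BSub => x + 2 ^ w - y
  | BMul => x * y
  | BDiv => x %/ y
  | BMod => x %% y
  | BAnd => Nat.land x y
  | BOr => Nat.lor x y
  | BXor => Nat.lxor x y
  | BShl => x * 2 ^ y
  | BShr => x %/ 2 ^ y
  end %% 2 ^ w.

Inductive instr : Type :=
| Const (r c : nat)
| Op (o : binop) (r r1 r2 : nat)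
| Read (r ra : nat)
| Write (ra r : nat)
| Jump (l : nat)
| JumpEq (r1 r2 l : nat)
| JumpLt (r1 r2 l : nat)
| Halt (b : bool).

Definition program := seq instr.

Record config : Type := Config { pc : nat; reg : nat -> nat; mem : nat -> nat }.

Definition upd (f : nat -> nat) (i x : nat) : nat -> nat :=
  fun j => if j == i then x else f j.

Definition exec (w : nat) (i : instr) (s : config) : config :=
  let: Config p g h := s in
  match i with
  | Const r c => Config p.+1 (upd g r (c %% 2 ^ w)) h
  | Op o r r1 r2 => Config p.+1 (upd g r (eval_binop w o (g r1) (g r2))) h
  | Read r ra => Config p.+1 (upd g r (h (g ra))) h
  | Write ra r => Config p.+1 g (upd h (g ra) (g r))
  | Jump l => Config l g h
  | JumpEq r1 r2 l => Config (if g r1 == g r2 then l else p.+1) g h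
  | JumpLt r1 r2 l => Config (if g r1 < g r2 then l else p.+1) g h
  | Halt _ => s
  end.

(* The answer given within [time] steps, if any, counting the final [Halt];
   leaving the program text rejects. *)
Fixpoint run (w : nat) (P : program) (time : nat) (s : config) : option bool :=
  if time is time'.+1 then
    match nth (Halt false) P (pc s) with
    | Halt b => Some b
    | i => run w P time' (exec w i s)
    end
  else None.

(* The input occupies the cells 0, 1, ..., its length is in register 0, and
   everything else is 0. *)
Definition init (w : nat) (x : seq nat) : config :=
  Config 0 (upd (fun=> 0) 0 (size x %% 2 ^ w)) (fun i => nth 0 x i %% 2 ^ w).

Definition decides_within (w : nat) (P : program) (x : seq nat) (time : nat)
    (Q : Prop) : Prop :=
  exists b : bool, run w P time (init w x) = Some b /\ (b <-> Q).

(* Preorder traversal: a leaf is written as 0 and its letter, an inner node as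
   the code of its label and its number of children.  For a homogeneous
   expression the length of the encoding is linear in [rsize]. *)
Fixpoint encode (r : regex) : seq nat :=
  match r with
  | RLeaf c => [:: 0; c]
  | RCat l => [:: rop_code OCat, size l & flatten (map encode l)]
  | RAlt l => [:: rop_code OAlt, size l & flatten (map encode l)]
  | RPlus r1 => [:: rop_code OPlus, 1 & encode r1]
  | RStar r1 => [:: rop_code OStar, 1 & encode r1]
  end.

(* Main.v *)
(** A word of [L(A)] is a power of [T], hence a prefix, of length divisible by
    [|T|], of the periodic word [cyc T], and it is read through a pointer that
    wraps around the end of [T].

    - [*o]: the empty word is always common.
    - [+o]: [T] and [U] have a common nonempty power iff [TU = UT].
    - [|o]: compare each string of the union with [cyc T].
    - [o|]: the length of the common word is forced, so test the letters of
      [cyc T] against the successive classes.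
    - [o+]: a maximal block of items with the same letter [c] matches a block of
      [c]'s in [cyc T], and it can only exceed its minimal length if it contains
      some [c+].  The blocks of [cyc T] may be much longer than [n] altogether, so
      a backward pass over [T] first computes where the block of each position
      ends; the surplus letters are then skipped in constant time, at most twice
      per block since it may wrap around the end of [T].  The last block of items
      need not exhaust its block of [cyc T], only reach the end of [T]. *)

Require Import Defs.
From Stdlib Require Import FunctionalExtensionality.
From mathcomp Require Import all_boot zify.

Set Implicit Arguments.
Unset Strict Implicit.
Unset Printing Implicit Defensive.

(** * Homogeneous expressions and powers *)

Definition cyc (T : seq nat) (i : nat) : nat := nth 0 T (i %% size T).

Lemma flatten_nseq_cyc T k : flatten (nseq k T) = mkseq (cyc T) (k * size T).
Proof.
elim: k => [|k IHk] //=; rewrite IHk mulSn /mkseq iotaD map_cat; congr (_ ++ _).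
  rewrite -[LHS](mkseq_nth 0); apply/eq_in_map => i.
  by rewrite mem_iota add0n /cyc => /andP[_ ltiT]; rewrite modn_small.
rewrite add0n; have:= iotaDl (size T) 0 (k * size T); rewrite addn0 => ->.
rewrite -map_comp.
by apply: eq_map => i; rewrite /cyc /= modnDl.
Qed.

(** A child of the root: a tag, which is 0 for a leaf and otherwise the code of the label, and the
    string of its letters. *)
Definition node : Type := (nat * seq nat)%type.

Definition node_regex (o : rop) (nd : node) : regex :=
  if nd.1 == 0 then RLeaf (head 0 nd.2) else
  match o with
  | OCat => RCat (map RLeaf nd.2)
  | OAlt => RAlt (map RLeaf nd.2)
  | OPlus => RPlus (RLeaf (head 0 nd.2))
  | OStar => RStar (RLeaf (head 0 nd.2))
  end.

Definition wf_node (o : rop) (nd : node) : bool :=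
  [&& 0 < size nd.2, (nd.1 == 0) || (nd.1 == rop_code o)
    & (nd.1 == 0) || (o \in [:: OPlus; OStar]) ==> (size nd.2 == 1)].

Definition pairs (s : seq nat) : seq nat := flatten [seq [:: 0; c] | c <- s].

(** A leaf contributes its tag as the 0 of its only pair, so the first cell holds the tag in every
    case that [wf_node] allows. *)
Definition node_code (nd : node) : seq nat :=
  if nd.1 == 0 then pairs nd.2 else [:: nd.1, size nd.2 & pairs nd.2].

Lemma all_leafP l : all is_leaf l -> exists s, l = map RLeaf s.
Proof.
elim: l => [_|r l IHl /= /andP[r_leaf /IHl[s ->]]]; first by exists [::].
by case: r r_leaf => // c _; exists (c :: s).
Qed.

Lemma pairsE s : flatten (map encode (map RLeaf s)) = pairs s.
Proof. by rewrite -map_comp. Qed.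

Lemma leavesE s : flatten (map leaves (map RLeaf s)) = s.
Proof. by elim: s => //= c s ->. Qed.

Lemma size1P (s : seq nat) : size s == 1 -> s = [:: head 0 s].
Proof. by case: s => [|c []]. Qed.

Lemma child_node o r :
  is_leaf r || inner_node o r && all is_leaf (children r) ->
  exists2 nd, r = node_regex o nd & wf_node o nd.
Proof.
case/orP=> [|/andP[/andP[/eqP r_lab]]].
  by case: r => // c _; exists (0, [:: c]).
case: r r_lab => [c|l|l|r|r] //= [<-] l_nil /= l_leaf.
- case/all_leafP: l_leaf => s def_l; exists (1, s); first by rewrite def_l.
  by rewrite /wf_node /= andbT; case: s def_l l_nil => // ->.
- case/all_leafP: l_leaf => s def_l; exists (2, s); first by rewrite def_l.
  by rewrite /wf_node /= andbT; case: s def_l l_nil => // ->.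
- by case: r l_leaf {l_nil} => // c _; exists (3, [:: c]).
- by case: r l_leaf {l_nil} => // c _; exists (4, [:: c]).
Qed.

Lemma encode_node o nd : wf_node o nd -> encode (node_regex o nd) = node_code nd.
Proof.
case: nd => g s /and3P[/= s_gt0 /orP[]/eqP-> s1]; rewrite /node_regex /node_code /=.
  by rewrite [in RHS](size1P s1).
by case: o s1 => /= s1; rewrite ?size_map ?pairsE // [in RHS](size1P s1).
Qed.

Lemma leaves_node o nd : wf_node o nd -> leaves (node_regex o nd) = nd.2.
Proof.
case: nd => g s /and3P[/= s_gt0 /orP[]/eqP-> s1]; rewrite /node_regex /=.
  by rewrite [in RHS](size1P s1).
by case: o s1 => /= s1; rewrite ?leavesE // [in RHS](size1P s1).
Qed.

Lemma encode_inner o r : inner_node o r ->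
  encode r =
    [:: rop_code o, size (children r) & flatten (map encode (children r))].
Proof.
rewrite /inner_node; case: r => [c|l|l|r|r] //= /andP[/eqP[<-]] //= _;
  by rewrite cats0.
Qed.

Lemma leaves_inner o r :
  inner_node o r -> leaves r = flatten (map leaves (children r)).
Proof.
by case: r => [c|l|l|r|r] //= _; rewrite cats0.
Qed.

Lemma homogeneousP (t : rop * rop) r : homogeneous t r ->
  exists bs, [/\ children r = map (node_regex t.2) bs, 0 < size bs,
    all (wf_node t.2) bs, leaves r = flatten (map snd bs)
    & encode r = [:: rop_code t.1, size bs & flatten (map node_code bs)]].
Proof.
case/andP=> r_in r_ch.
have [bs [def_bs wf_bs]]: exists bs, children r = map (node_regex t.2) bs /\
    all (wf_node t.2) bs.
  elim: (children r) r_ch => [_|r1 l IHl]; first by exists [::].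
  case/andP=> /child_node[nd -> wf_nd] /IHl[bs [-> wf_bs]].
  by exists (nd :: bs); split=> //=; rewrite wf_nd.
exists bs; rewrite (leaves_inner r_in) (encode_inner r_in) def_bs size_map.
split=> //.
- by case/andP: r_in => _; rewrite def_bs; case: (bs).
- congr flatten; rewrite -map_comp; apply/eq_in_map => nd /(allP wf_bs).
  exact: leaves_node.
- congr [:: _, _ & flatten _]; rewrite -map_comp; apply/eq_in_map => nd.
  by move/(allP wf_bs)=> wf_nd; exact: encode_node.
Qed.

Lemma lcat_letters s u :
  foldr lcat leps (map lang (map RLeaf s)) u <-> u = s.
Proof.
elim: s u => [|c s IHs] u //=; split=> [[s1 [s2 [-> [-> /IHs->]]]] //|->].
by exists [:: c], s; split; rewrite ?IHs.
Qed.

Lemma lalt_letters s u :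
  foldr lalt lempty (map lang (map RLeaf s)) u <->
  exists2 c, c \in s & u = [:: c].
Proof.
elim: s u => [|c s IHs] u /=; first by split=> // [[]].
split=> [[->|/IHs[c1 c1s ->]]|[c1]]; first by exists c; rewrite ?mem_head.
  by exists c1; rewrite // inE c1s orbT.
rewrite inE => /orP[/eqP->|c1s ->]; first by left.
by right; apply/IHs; exists c1.
Qed.

Lemma lpow1 (L : language) (T : seq nat) k u :
  (forall v, L v <-> v = T) -> lpow L k u <-> u = flatten (nseq k T).
Proof.
move=> LT; elim: k u => [|k IHk] u //=; split.
  by case=> u1 [u2 [-> [/LT-> /IHk->]]].
by move=> ->; exists T, (flatten (nseq k T)); rewrite LT IHk.
Qed.

Lemma lpow_letter c k u : lpow (lang (RLeaf c)) k u <-> u = nseq k c.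
Proof.
have -> : nseq k c = flatten (nseq k [:: c]) by elim: k => //= k ->.
exact: lpow1.
Qed.

Lemma lang_cat_node nd u : wf_node OCat nd ->
  lang (node_regex OCat nd) u <-> u = nd.2.
Proof.
case: nd => g s /and3P[/= s_gt0 /orP[]/eqP-> s1]; rewrite /node_regex /=.
  by rewrite [in X in _ <-> X](size1P s1).
exact: lcat_letters.
Qed.

Lemma lang_alt_node nd u : wf_node OAlt nd ->
  lang (node_regex OAlt nd) u <-> exists2 c, c \in nd.2 & u = [:: c].
Proof.
case: nd => g s /and3P[/= s_gt0 /orP[]/eqP-> s1]; rewrite /node_regex /=.
  rewrite (size1P s1) /=; split=> [->|[c]]; first by exists (head 0 s); rewrite ?mem_head.
  by rewrite inE => /eqP->.
exact: lalt_letters.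
Qed.

Lemma lang_plus_node nd u : wf_node OPlus nd ->
  lang (node_regex OPlus nd) u <->
  exists2 k, (0 < k) && ((nd.1 != 0) || (k == 1)) & u = nseq k (head 0 nd.2).
Proof.
case: nd => g s /and3P[/= s_gt0 /orP[]/eqP-> s1]; rewrite /node_regex /=.
  split=> [->|[k /andP[_ /eqP->] //]]; by exists 1.
split=> [[k k_gt0 /lpow_letter->]|[k /andP[k_gt0 _] ->]].
  by exists k; rewrite ?k_gt0.
by exists k => //; apply/lpow_letter.
Qed.

(** A star has exactly one child, possibly a leaf, whose letters form the string T. *)
Lemma lang_star A : homogeneous (OStar, OCat) A ->
  exists2 nd, wf_node OCat nd & [/\ leaves A = nd.2,
    encode A = [:: 4, 1 & node_code nd]
    & forall u, lang A u <-> exists k, u = flatten (nseq k nd.2)].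
Proof.
move=> homA; case/andP: (homA) => inA _; have [bs] := homogeneousP homA.
case: A inA {homA} => [c|l|l|r|r] // _ [/=].
case: bs => [|nd [|nd1 bs]] //= [->] _; rewrite andbT => wf_nd -> ->.
exists nd => //; split=> [||u]; rewrite ?cats0 //.
have powE k : lpow (lang (node_regex OCat nd)) k u <-> u = flatten (nseq k nd.2).
  by apply: lpow1 => v; exact: lang_cat_node.
by split=> -[k /powE uk]; exists k.
Qed.

(** * Symbolic execution *)

(** Registers as a list with default 0, so that symbolic execution reads and updates them by
    computation. *)
Definition st (p : nat) (l : seq nat) (h : nat -> nat) : config :=
  Config p (nth 0 l) h.

(** Unlike [decides_within], this starts from any configuration, so the rules below can peel off one
    instruction at a time. *)
Definition dec (w : nat) (P : program) (t : nat) (s : config) (Q : Prop) :=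
  exists b : bool, run w P t s = Some b /\ (b <-> Q).

Local Notation "P @ p" := (nth (Halt false) P p) (at level 9, only parsing).

Arguments modn : simpl never.
Arguments eval_binop : simpl never.

Lemma run_addn w P t t' s b :
  run w P t s = Some b -> run w P (t + t') s = Some b.
Proof.
elim: t s => // t IHt s; rewrite addSn /=.
by case: (nth _ _ _) => *; auto.
Qed.

Lemma run_step w P t p l h i :
  P @ p = i -> (forall b, i <> Halt b) ->
  run w P t.+1 (st p l h) = run w P t (exec w i (st p l h)).
Proof. by move=> /= -> ni; case: i ni => // b /(_ b). Qed.

Lemma dec_le t w P t' s Q : t <= t' -> dec w P t s Q -> dec w P t' s Q.
Proof.
move=> le_t [b [run_b bQ]]; exists b; split=> //.
by rewrite -(subnKC le_t); exact: run_addn.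
Qed.

Lemma dec_iff Q w P t s Q' : (Q <-> Q') -> dec w P t s Q -> dec w P t s Q'.
Proof. by move=> QQ' [b [run_b bQ]]; exists b; rewrite -QQ'. Qed.

Lemma upd_nth l r x : upd (nth 0 l) r x = nth 0 (set_nth 0 l r x).
Proof.
by apply: functional_extensionality => i; rewrite nth_set_nth /upd /=.
Qed.

Lemma dec_const w P t p l h Q r c :
  P @ p = Const r c -> c < 2 ^ w ->
  dec w P t (st p.+1 (set_nth 0 l r c) h) Q -> dec w P t.+1 (st p l h) Q.
Proof.
by move=> Pp c_lt; rewrite /dec (run_step _ _ _ _ Pp) //= modn_small // upd_nth.
Qed.

Lemma dec_add w P t p l h Q r r1 r2 :
  P @ p = Op BAdd r r1 r2 -> nth 0 l r1 + nth 0 l r2 < 2 ^ w ->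
  dec w P t (st p.+1 (set_nth 0 l r (nth 0 l r1 + nth 0 l r2)) h) Q ->
  dec w P t.+1 (st p l h) Q.
Proof.
move=> Pp lt_w; rewrite /dec (run_step _ _ _ _ Pp) //=.
by rewrite /eval_binop modn_small // upd_nth.
Qed.

Lemma dec_sub w P t p l h Q r r1 r2 :
  P @ p = Op BSub r r1 r2 -> nth 0 l r2 <= nth 0 l r1 < 2 ^ w ->
  dec w P t (st p.+1 (set_nth 0 l r (nth 0 l r1 - nth 0 l r2)) h) Q ->
  dec w P t.+1 (st p l h) Q.
Proof.
move=> Pp /andP[le_r lt_w]; rewrite /dec (run_step _ _ _ _ Pp) //=.
rewrite /eval_binop -addnBAC // modnDr.
by rewrite modn_small ?upd_nth //; lia.
Qed.

Lemma dec_read w P t p l h Q r ra :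
  P @ p = Read r ra ->
  dec w P t (st p.+1 (set_nth 0 l r (h (nth 0 l ra))) h) Q ->
  dec w P t.+1 (st p l h) Q.
Proof. by move=> Pp; rewrite /dec (run_step _ _ _ _ Pp) // /= upd_nth. Qed.

Lemma dec_write w P t p l h Q ra r :
  P @ p = Write ra r ->
  dec w P t (st p.+1 l (upd h (nth 0 l ra) (nth 0 l r))) Q ->
  dec w P t.+1 (st p l h) Q.
Proof. by move=> Pp; rewrite /dec (run_step _ _ _ _ Pp) //. Qed.

Lemma dec_jump w P t p l h Q p' :
  P @ p = Jump p' -> dec w P t (st p' l h) Q -> dec w P t.+1 (st p l h) Q.
Proof. by move=> Pp; rewrite /dec (run_step _ _ _ _ Pp) //. Qed.

Lemma dec_jeq w P t p l h Q r1 r2 p' :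
  P @ p = JumpEq r1 r2 p' ->
  (nth 0 l r1 = nth 0 l r2 -> dec w P t (st p' l h) Q) ->
  (nth 0 l r1 <> nth 0 l r2 -> dec w P t (st p.+1 l h) Q) ->
  dec w P t.+1 (st p l h) Q.
Proof.
move=> Pp; rewrite /dec (run_step _ _ _ _ Pp) // /=.
by case: eqP => // eq_r tt ff; [exact: tt | exact: ff].
Qed.

Lemma dec_jlt w P t p l h Q r1 r2 p' :
  P @ p = JumpLt r1 r2 p' ->
  (nth 0 l r1 < nth 0 l r2 -> dec w P t (st p' l h) Q) ->
  (nth 0 l r2 <= nth 0 l r1 -> dec w P t (st p.+1 l h) Q) ->
  dec w P t.+1 (st p l h) Q.
Proof.
move=> Pp; rewrite /dec (run_step _ _ _ _ Pp) // /=.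
by case: ltnP => // lt_r tt ff; [exact: tt | exact: ff].
Qed.

Lemma dec_halt w P t p l h (Q : Prop) b :
  P @ p = Halt b -> (b <-> Q) -> dec w P t.+1 (st p l h) Q.
Proof. by move=> Pp bQ; rewrite /dec /= Pp; exists b. Qed.

(** * Encoded nodes in memory and their parsing *)

Definition sits (h : nat -> nat) (a : nat) (s : seq nat) : Prop :=
  forall i, i < size s -> h (a + i) = nth 0 s i.

Lemma sits_cat h a s1 s2 :
  sits h a (s1 ++ s2) <-> sits h a s1 /\ sits h (a + size s1) s2.
Proof.
split=> [hs|[hs1 hs2] i].
  split=> i lti; first by rewrite hs ?nth_cat ?lti // size_cat ltn_addr.
  by rewrite -addnA hs ?nth_cat ?size_cat ?ltn_add2l // ltnNge leq_addr /= addKn.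
rewrite size_cat nth_cat => lt_i; case: ltnP => [/hs1 //|le_i].
by rewrite -hs2 -?addnA ?subnKC // ltn_subLR.
Qed.

Lemma size_pairs s : size (pairs s) = (size s).*2.
Proof. by elim: s => //= c s; rewrite -/(pairs s) doubleS => ->. Qed.

Lemma sits_pairs h a s i : sits h a (pairs s) -> i < size s ->
  h (a + i.*2) = 0 /\ h (a + i.*2 + 1) = nth 0 s i.
Proof.
move=> hs lti; rewrite -addnA !hs ?size_pairs; [|lia|lia].
elim: s i lti {hs} => [|c s IHs] [|i] //= /IHs; rewrite -/(pairs s).
by rewrite ?doubleS !addn1 /= => -[-> ->].
Qed.

Lemma size_node_code nd :
  size (node_code nd) = (nd.1 != 0).*2 + (size nd.2).*2.
Proof. by rewrite /node_code; case: eqP => _; rewrite /= size_pairs. Qed.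

(** Jump targets are absolute, hence the offset [o]. The registers are first set as for a leaf, then
    corrected if the tag is nonzero. *)
Definition parse (o : nat) : program :=
  [:: Read 7 4; Op BAdd 6 4 12; Op BAdd 5 4 10; JumpEq 7 10 (9 + o);
      Op BAdd 5 4 12; Op BAdd 8 4 11; Read 8 8; Op BAdd 8 8 8; Op BAdd 6 5 8].

Definition code_at (P : program) (o : nat) (c : program) : Prop :=
  forall i, i < size c -> P @ (i + o) = c @ i.

Ltac dec_step lem H i := apply: (lem); [exact: (H i isT)|..]; rewrite /=.

Lemma dec_parse w P o t e tb te tp a lp le tag t1 t2 c f h (nd : node) Q :
  let base := a + (nd.1 != 0).*2 in
  code_at P o (parse o) -> sits h a (node_code nd) ->
  0 < size nd.2 -> (nd.1 = 0 -> size nd.2 = 1) ->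
  a + size (node_code nd) + 2 < 2 ^ w ->
  (forall t1, dec w P t (st (9 + o)
    [:: e; tb; te; tp; a; base; base + (size nd.2).*2; nd.1; t1; t2; 0; 1; 2; c; f]
    h) Q) ->
  dec w P (9 + t)
    (st o [:: e; tb; te; tp; a; lp; le; tag; t1; t2; 0; 1; 2; c; f] h) Q.
Proof.
move=> base oP ha s_gt0 s1; rewrite size_node_code => lt_w IH.
rewrite !addSn !add0n in IH *.
dec_step dec_read oP 0.
have ->: h a = nd.1.
  move: (ha 0); rewrite addn0 size_node_code => -> //; last by lia.
  by rewrite /node_code; case: eqP => [->|] //; case: (nd.2).
dec_step dec_add oP 1; first by lia.
dec_step dec_add oP 2; first by lia.
rewrite addn0.
dec_step dec_jeq oP 3 => tag0.
  apply: (dec_le (t := t)); first by lia.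
  by move: (IH t1); rewrite /base tag0 (s1 tag0) /= addn0.
have tag1 : nd.1 != 0 by apply/eqP.
have base2 : base = a + 2 by rewrite /base tag1.
rewrite {}base2 in IH; rewrite tag1 /= in lt_w.
dec_step dec_add oP 4; first by lia.
dec_step dec_add oP 5; first by lia.
dec_step dec_read oP 6.
have -> : h (a + 1) = size nd.2.
  by rewrite ha ?size_node_code /node_code ?tag1 ?(negPf tag1) //; lia.
dec_step dec_add oP 7; first by lia.
dec_step dec_add oP 8; first by lia.
by rewrite addnn; exact: IH.
Qed.
Arguments dec_parse {w P o t e tb te tp a lp le tag t1 t2 c f h nd Q}.

(** For a concrete program the current instruction is found by computation; [dec_step] serves the
    fragments placed at a variable offset. *)
Ltac dec_eval := match goal with |- dec _ ?P _ (st ?p _ _) _ =>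
  let i := eval hnf in (nth (Halt false) P p) in
  match i with
  | Const _ _ => apply: dec_const; [reflexivity| |]
  | Op BAdd _ _ _ => apply: dec_add; [reflexivity| |]
  | Op BSub _ _ _ => apply: dec_sub; [reflexivity| |]
  | Read _ _ => apply: dec_read; [reflexivity|]
  | Write _ _ => apply: dec_write; [reflexivity|]
  | Jump _ => apply: dec_jump; [reflexivity|]
  | JumpEq _ _ _ => apply: dec_jeq; [reflexivity| |]
  | JumpLt _ _ _ => apply: dec_jlt; [reflexivity| |]
  | Halt _ => apply: dec_halt; [reflexivity|]
  end end; rewrite /= ?addn0; try lia.

(** Only the letter cells are constrained: for type [o+] the cells in front of the letters of T get
    overwritten. *)
Definition letters_at (h : nat -> nat) (a : nat) (s : seq nat) : Prop :=
  forall i, i < size s -> h (a + i.*2 + 1) = nth 0 s i.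

Lemma sits_letters h a (nd : node) : sits h a (node_code nd) ->
  letters_at h (a + (nd.1 != 0).*2) nd.2.
Proof.
move=> hs i lti; suff hp : sits h (a + (nd.1 != 0).*2) (pairs nd.2).
  by have [] := sits_pairs hp lti.
move: hs; rewrite /node_code; case: eqP => _ /=; first by rewrite addn0.
by rewrite -[[:: _, _ & _]]/([:: _; _] ++ _) => /sits_cat[].
Qed.

Ltac code_at_tac := rewrite /code_at; by do 9 try (case=> [//|]).

(** What the programs need of [wf_node], independently of the label. *)
Definition good (nd : node) : bool :=
  (0 < size nd.2) && ((nd.1 == 0) ==> (size nd.2 == 1)).

Lemma goodP nd : good nd -> 0 < size nd.2 /\ (nd.1 = 0 -> size nd.2 = 1).
Proof. by case/andP=> nd_gt0 /implyP nd1; split=> // /eqP/nd1/eqP. Qed.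

(** * Common opening of the programs and the cyclic pointer *)

(* Registers: 0 length of the input; 1, 2 first address and end of [T]; 3 pointer
   into [T]; 4 address of the current child of [B], then second pointer in
   [plus_body]; 5, 6 first address and end of
   its letters; 7 its tag, 0 for a leaf; 8, 9 scratch; 10, 11, 12 the constants
   0, 1, 2; 13, 14 last letter and prolongation flag of [runs_body].  A letter of
   a string is stored one cell after the address denoting its position. *)
Definition start : program :=
  [:: Const 11 1; Const 12 2; Const 4 2] ++ parse 3 ++
  [:: Op BAdd 1 5 10; Op BAdd 2 6 10; Op BAdd 3 5 10; Op BAdd 4 6 12].

Lemma dec_start w body t e h (nd : node) Q :
  let tb := 2 + (nd.1 != 0).*2 in
  let te := tb + (size nd.2).*2 in
  let P := start ++ body in
  sits h 2 (node_code nd) -> 0 < size nd.2 -> (nd.1 = 0 -> size nd.2 = 1) ->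
  te + 4 < 2 ^ w ->
  (forall t1, dec w P t
    (st 16 [:: e; tb; te; tb; te + 2; tb; te; nd.1; t1; 0; 0; 1; 2; 0; 0] h) Q) ->
  dec w P (16 + t) (st 0 (e :: nseq 14 0) h) Q.
Proof.
move=> tb te P hs s_gt0 s1 lt_w IH; have := size_node_code nd => sz.
rewrite !addSn add0n; do 3 dec_eval.
rewrite -[t.+4.+4.+4.+1]/(9 + t.+4).
apply: (dec_parse _ hs s_gt0 s1); first 1 last.
- by rewrite sz; lia.
- move=> t1; rewrite -/tb -/te; do 4 dec_eval; exact: IH.
by code_at_tac.
Qed.

Lemma modS_wrap q m : 0 < m ->
  q.+1 %% m = if (q %% m).+1 < m then (q %% m).+1 else 0.
Proof.
move=> m_gt0; rewrite -addn1 -modnDml addn1; case: ltnP => [/modn_small//|].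
have := ltn_pmod q m_gt0 => lt_q le_m.
by have -> : (q %% m).+1 = m; rewrite ?modnn; lia.
Qed.

(** The values 4 and 1 stand for the star of A with its one child, [g] for the code of the root of
    B. *)
Definition input (T : node) (g : nat) (bs : seq node) : seq nat :=
  [:: 4; 1] ++ node_code T ++ [:: g; size bs] ++ flatten (map node_code bs).

Lemma dec_start_list w body t h (T : node) g (bs : seq node) Q :
  let x := input T g bs in
  let P := start ++ body in
  sits h 0 x -> good T -> size x + 4 < 2 ^ w ->
  (forall tb t1, let te := tb + (size T.2).*2 in
    letters_at h tb T.2 -> sits h (te + 2) (flatten (map node_code bs)) ->
    size x = te + 2 + size (flatten (map node_code bs)) -> te + 4 < 2 ^ w ->
    dec w P t (st 16
      [:: size x; tb; te; tb; te + 2; tb; te; T.1; t1; 0; 0; 1; 2; 0; 0] h) Q) ->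
  dec w P (16 + t) (st 0 (size x :: nseq 14 0) h) Q.
Proof.
move=> x P; rewrite /x /input => /sits_cat[_ /sits_cat[hT /sits_cat[_ hbs]]].
rewrite !size_cat !add0n /= in hbs *.
have szT := size_node_code T => /goodP[T_gt0 T1] lt_w IH.
apply: (dec_start hT) => // [|t1]; first by lia.
apply: IH; [exact: sits_letters | | by lia | by lia].
by move: hbs; congr sits; lia.
Qed.

Definition adv (o : nat) : program :=
  [:: Op BAdd 3 3 12; JumpLt 3 2 (3 + o); Op BAdd 3 1 10].

Lemma dec_adv w P o t e tb te q m a lp le tag t1 t2 c f h Q :
  let tp q := tb + (q %% m).*2 in
  code_at P o (adv o) -> 0 < m -> te = tb + m.*2 -> te + 2 < 2 ^ w ->
  dec w P t (st (3 + o)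
    [:: e; tb; te; tp q.+1; a; lp; le; tag; t1; t2; 0; 1; 2; c; f] h) Q ->
  dec w P (3 + t)
    (st o [:: e; tb; te; tp q; a; lp; le; tag; t1; t2; 0; 1; 2; c; f] h) Q.
Proof.
move=> tp oP m_gt0 teE lt_w IH; rewrite !addSn !add0n in IH *.
have lt_qm := ltn_pmod q m_gt0; have lt_q1m := ltn_pmod q.+1 m_gt0.
rewrite /tp modS_wrap // in IH *.
dec_step dec_add oP 0; first by lia.
dec_step dec_jlt oP 1 => cmp.
  apply: (dec_le (t := t)) => //; move: IH.
  case: ifP => [_|?]; last by lia.
  by have -> : tb + (q %% m).+1.*2 = tb + (q %% m).*2 + 2 by lia.
dec_step dec_add oP 2; first by lia.
by move: IH; case: ifP => [?|_]; first by lia.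
Qed.
Arguments dec_adv {w P o t e tb te q m a lp le tag t1 t2 c f h Q}.

(** * Type [+o]: commutation of two strings *)

Definition plus_body : program := parse 16 ++
  [:: Op BAdd 4 5 10;
      (* 26 *) JumpEq 3 6 42;
      Op BAdd 8 3 11; Read 8 8; Op BAdd 9 4 11; Read 9 9;
      (* 31 *) JumpEq 8 9 33; Halt false;
      (* 33 *) Op BAdd 3 3 12; Op BAdd 4 4 12;
      (* 35 *) JumpEq 3 2 37; Jump 38; Op BAdd 3 5 10;
      (* 38 *) JumpEq 4 6 40; Jump 26; Op BAdd 4 1 10; Jump 26;
      (* 42 *) Halt true].

(* The position of letter number [i] of a concatenation whose first factor has
   [m] letters and is stored at [a], the second one being stored at [b]. *)
Definition walk (m a b i : nat) : nat :=
  if i < m then a + i.*2 else b + (i - m).*2.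

(** Lockstep invariant: the first [i] letters of both products agree and [k] remain. Since
    [te < lb], comparing an address with [te] or [le] recognizes the end of a string unambiguously.
    A round takes at most 16 instructions. *)
Lemma dec_plus_loop w k i e tb lb tag t1 t2 h (T U : seq nat) :
  let te := tb + (size T).*2 in
  let le := lb + (size U).*2 in
  let P := start ++ plus_body in
  0 < size T -> 0 < size U ->
  letters_at h tb T -> letters_at h lb U -> te < lb -> le + 4 < 2 ^ w ->
  i + k = size T + size U -> take i (T ++ U) = take i (U ++ T) ->
  dec w P (16 * k.+1) (st 26
    [:: e; tb; te; walk (size T) tb lb i; walk (size U) lb tb i; lb; le; tag;
        t1; t2; 0; 1; 2; 0; 0] h)
    (T ++ U = U ++ T).
Proof.
move=> te le P T_gt0 U_gt0 hT hU lt_te lt_le.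
elim: k i t1 t2 => [|k IHk] i t1 t2 szk eq_i; rewrite mulnS !addSn add0n.
  dec_eval; last first.
  by case; rewrite /walk; case: ifP; lia.
  move=> _; dec_eval; split=> // _; move: eq_i.
  by rewrite !take_oversize ?size_cat //; lia.
dec_eval.
  by rewrite /walk => eq_x; exfalso; move: eq_x; case: ifP; lia.
move=> _.
have x_lt : walk (size T) tb lb i + 4 < 2 ^ w by rewrite /walk; case: ifP; lia.
have y_lt : walk (size U) lb tb i + 4 < 2 ^ w by rewrite /walk; case: ifP; lia.
do 4 dec_eval.
have -> : h (walk (size T) tb lb i + 1) = nth 0 (T ++ U) i.
  by rewrite /walk nth_cat; case: ltnP => [/hT//|le_i]; apply: hU; lia.
have -> : h (walk (size U) lb tb i + 1) = nth 0 (U ++ T) i.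
  by rewrite /walk nth_cat; case: ltnP => [/hU//|le_i]; apply: hT; lia.
dec_eval => [eq_t|neq_t]; last first.
  by dec_eval; split=> // eq_TU; case: neq_t; rewrite eq_TU.
do 2 dec_eval.
have x1 : walk (size T) tb lb i.+1 =
    if walk (size T) tb lb i + 2 == te then lb else walk (size T) tb lb i + 2.
  by rewrite /walk; do 2 (case: ltnP => ?); case: eqP; lia.
have y1 : walk (size U) lb tb i.+1 =
    if walk (size U) lb tb i + 2 == le then tb else walk (size U) lb tb i + 2.
  by rewrite /walk; do 2 (case: ltnP => ?); case: eqP; lia.
have {}IHk t3 t4 : dec w P (16 * k.+1) (st 26 [:: e; tb; te;
    walk (size T) tb lb i.+1; walk (size U) lb tb i.+1; lb; le; tag; t3; t4;
    0; 1; 2; 0; 0] h) (T ++ U = U ++ T).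
  apply: IHk; first by lia.
  by rewrite !(take_nth 0) ?size_cat ?eq_i ?eq_t //; lia.
(* The two pointers wrap independently; [next] settles the second one for both outcomes of the
   first. *)
suff {x1} next t3 t4 t : 16 * k.+1 + 4 <= t -> dec w P t (st 38 [:: e; tb; te;
    walk (size T) tb lb i.+1; walk (size U) lb tb i + 2; lb; le; tag; t3; t4;
    0; 1; 2; 0; 0] h) (T ++ U = U ++ T).
  rewrite x1 in next; dec_eval => [eq_x|/eqP neq_x].
    by dec_eval; rewrite eq_x eqxx in next; apply: next; lia.
  by dec_eval; rewrite (negPf neq_x) in next; apply: next; lia.
move=> /dec_le; apply; rewrite addnC !addSn add0n; rewrite y1 in IHk.
dec_eval => [eq_y|/eqP neq_y].
  do 2 dec_eval; rewrite eq_y eqxx in IHk.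
  by apply: (dec_le _ (IHk _ _)); lia.
dec_eval; rewrite (negPf neq_y) in IHk.
by apply: (dec_le _ (IHk _ _)); lia.
Qed.

Lemma dec_plus w h (T U : node) g :
  let x := input T g [:: U] in
  sits h 0 x -> good T -> good U -> size x + 4 < 2 ^ w ->
  dec w (start ++ plus_body) (60 * (size T.2 + size U.2))
    (st 0 (size x :: nseq 14 0) h) (T.2 ++ U.2 = U.2 ++ T.2).
Proof.
move=> x hx gT /goodP[U_gt0 U1] lt_w; have [T_gt0 _] := goodP gT.
apply: (dec_le (t := 16 + (9 + (16 * (size T.2 + size U.2).+1).+1))); first by lia.
apply: (dec_start_list hx gT lt_w) => tb t1 te hT.
have -> : flatten (map node_code [:: U]) = node_code U by rewrite /= cats0.
rewrite -/x => hU; have szU := size_node_code U => ex lt_te.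
apply: (dec_parse _ hU U_gt0 U1) => [||t2]; [by code_at_tac | by lia |].
set lb := te + 2 + _; rewrite -[9 + 16]/25; dec_eval.
have := @dec_plus_loop w (size T.2 + size U.2) 0 (size x) tb lb U.1 t2 0 h T.2 U.2.
rewrite /walk T_gt0 U_gt0 !addn0 !take0; apply=> //; try by rewrite /lb; lia.
exact: sits_letters.
Qed.

(** * Type [|o]: powers of T among the strings of a union *)

Definition is_power (T s : seq nat) : bool :=
  (size T %| size s) && (s == mkseq (cyc T) (size s)).

Definition alt_body : program :=
  [:: (* 16 *) JumpEq 4 0 43] ++ parse 17 ++
  [:: Op BAdd 3 1 10;
      (* 27 *) JumpEq 5 6 39;
      Op BAdd 8 3 11; Read 8 8; Op BAdd 9 5 11; Read 9 9;
      (* 32 *) JumpEq 8 9 34; Jump 40;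
      (* 34 *) Op BAdd 5 5 12] ++ adv 35 ++
  [:: (* 38 *) Jump 27;
      (* 39 *) JumpEq 3 1 42;
      (* 40 *) Op BAdd 4 6 10; Jump 16;
      (* 42 *) Halt true; Halt false].

(** Here [j] letters of U agree with [cyc T] and [k] are left. A failure only discards U: the run
    resumes at 40, where the next string is taken up, hence the continuation [npow]. *)
Lemma dec_alt_string w t k j e tb a lb tag t1 t2 h (T U : seq nat) Q :
  let te := tb + (size T).*2 in
  let le := lb + (size U).*2 in
  let P := start ++ alt_body in
  0 < size T -> letters_at h tb T -> letters_at h lb U ->
  te + 4 < 2 ^ w -> le + 4 < 2 ^ w ->
  j + k = size U -> take j U = mkseq (cyc T) j ->
  (is_power T U -> Q) ->
  (~~ is_power T U -> forall tp lp t1 t2, dec w P t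
    (st 40 [:: e; tb; te; tp; a; lp; le; tag; t1; t2; 0; 1; 2; 0; 0] h) Q) ->
  dec w P (12 * k + 4 + t) (st 27
    [:: e; tb; te; tb + (j %% size T).*2; a; lb + j.*2; le; tag; t1; t2;
        0; 1; 2; 0; 0] h) Q.
Proof.
move=> te le P T_gt0 hT hU lt_te lt_le + + powQ npow.
have lt_j q : q %% size T < size T by rewrite ltn_pmod.
elim: k j t1 t2 => [|k IHk] j t1 t2 szk eq_j.
  rewrite muln0 !addSn !add0n; dec_eval => _.
  (* All of U has been read, so |T| divides |U| exactly when the pointer is back at the start of
     T. *)
  have powE : is_power T U = (j %% size T == 0).
    rewrite /is_power /dvdn; have -> : size U = j by lia.
    by rewrite -eq_j take_oversize ?eqxx ?andbT; lia.
  dec_eval => [j0|jn0].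
    dec_eval; split=> // _; apply: powQ; rewrite powE; lia.
  by apply: (dec_le (t := t)); [lia | apply: npow; rewrite powE; lia].
rewrite mulnS !addSn !add0n; dec_eval.
move=> _; have := lt_j j => lt_jT.
do 4 dec_eval; rewrite hU ?hT; try lia.
dec_eval => [eq_t|neq_t]; last first.
  dec_eval; apply: (dec_le (t := t)); first by lia.
  apply: npow; apply/negP => /andP[_ /eqP defU]; case: neq_t.
  by rewrite [U]defU nth_mkseq //; lia.
dec_eval.
apply: (dec_le (t := 3 + (12 * k + 4 + t).+1)); first by lia.
apply: (dec_adv _ T_gt0) => //; [by code_at_tac | by lia |].
rewrite -[3 + 35]/38; dec_eval.
have -> : lb + j.*2 + 2 = lb + j.+1.*2 by lia.
apply: IHk; first by lia.
by rewrite (take_nth 0) ?eq_j -?eq_t -?cats1; [rewrite mkseqS cats1 | lia].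
Qed.

Lemma dec_alt_loop w e tb tp a lp le tag t1 t2 h (T : seq nat) (bs : seq node) :
  let te := tb + (size T).*2 in
  let P := start ++ alt_body in
  0 < size T -> letters_at h tb T -> te + 4 < 2 ^ w ->
  all good bs -> sits h a (flatten (map node_code bs)) ->
  e = a + size (flatten (map node_code bs)) -> e + 4 < 2 ^ w ->
  dec w P (40 * size (flatten (map snd bs)) + 2) (st 16
    [:: e; tb; te; tp; a; lp; le; tag; t1; t2; 0; 1; 2; 0; 0] h)
    (has (fun nd => is_power T nd.2) bs).
Proof.
move=> te P T_gt0 hT lt_te + + + lt_e.
elim: bs a tp lp le tag t1 t2 => [|nd bs IHbs] a tp lp le tag t1 t2 /=.
  move=> _ _ ->; rewrite addn0 muln0 add0n; dec_eval => // _.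
  by dec_eval.
case/andP=> /goodP[nd_gt0 nd1] gbs /sits_cat[hnd hbs].
rewrite !size_cat; have sz := size_node_code nd => eE.
set N := size (flatten (map snd bs)) in IHbs *.
(* The constant cost of a child is charged to its letters, of which there is at least one. *)
apply: (dec_le (t := (9 + (12 * size nd.2 + 4 + (40 * N + 4)).+1).+1)).
  by lia.
dec_eval => _.
apply: (dec_parse _ hnd nd_gt0 nd1) => [||t3]; [by code_at_tac | by lia |].
rewrite -[9 + 17]/26; have lt_nd : 0 < size (node_code nd) by lia.
dec_eval.
have := @dec_alt_string w (40 * N + 4) (size nd.2) 0 e tb a
  (a + (nd.1 != 0).*2) nd.1 t3 t2 h T nd.2.
rewrite mod0n !addn0; apply=> //; try lia.
- exact: sits_letters.
- by rewrite take0.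
move=> /negPf-> tp' lp' t1' t2'; rewrite orFb.
apply: (dec_le (t := (40 * N + 2).+2)); first by lia.
do 2 dec_eval.
have -> : a + (nd.1 != 0).*2 + (size nd.2).*2 = a + size (node_code nd) by lia.
by apply: IHbs => //; lia.
Qed.

Lemma dec_alt w h (T : node) g (bs : seq node) :
  let x := input T g bs in
  sits h 0 x -> good T -> all good bs -> size x + 4 < 2 ^ w ->
  dec w (start ++ alt_body) (60 * (size T.2 + size (flatten (map snd bs))))
    (st 0 (size x :: nseq 14 0) h) (has (fun nd => is_power T.2 nd.2) bs).
Proof.
move=> x hx gT gbs lt_w; have [T_gt0 _] := goodP gT.
apply: (dec_le (t := 16 + (40 * size (flatten (map snd bs)) + 2))); first by lia.
apply: (dec_start_list hx gT lt_w) => tb t1 te hT hbs ex lt_te.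
exact: dec_alt_loop.
Qed.

(** * Type [o|]: one class per position *)

Fixpoint classes_match (T : seq nat) (q : nat) (bs : seq node) : bool :=
  if bs is nd :: bs' then (cyc T q \in nd.2) && classes_match T q.+1 bs'
  else size T %| q.

Definition classes_body : program :=
  [:: (* 16 *) JumpEq 4 0 39] ++ parse 17 ++
  [:: Op BAdd 8 3 11; Read 8 8;
      (* 28 *) JumpEq 5 6 40;
      Op BAdd 9 5 11; Read 9 9;
      (* 31 *) JumpEq 8 9 34; Op BAdd 5 5 12; Jump 28] ++
  (* 34 *) adv 34 ++
  [:: (* 37 *) Op BAdd 4 6 10; Jump 16;
      (* 39 *) JumpEq 3 1 41;
      (* 40 *) Halt false; Halt true].

(** Linear search in one class: [j] of its letters have been ruled out and [k] are left. A value
    outside the class refutes the whole expression, so that branch halts. *)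
Lemma dec_class w t k j e tb te tp a lb (tag v t2 : nat) h (U : seq nat) Q :
  let le := lb + (size U).*2 in
  let P := start ++ classes_body in
  letters_at h lb U -> le + 4 < 2 ^ w ->
  j + k = size U -> v \notin take j U ->
  (v \notin U -> ~ Q) ->
  (v \in U -> forall lp t2, dec w P t
    (st 34 [:: e; tb; te; tp; a; lp; le; tag; v; t2; 0; 1; 2; 0; 0] h) Q) ->
  dec w P (6 * k + 2 + t) (st 28
    [:: e; tb; te; tp; a; lb + j.*2; le; tag; v; t2; 0; 1; 2; 0; 0] h) Q.
Proof.
move=> le P hU lt_le + + notQ inQ.
elim: k j t2 => [|k IHk] j t2 szk v_j.
  rewrite muln0 !addSn !add0n; dec_eval => _.
  rewrite take_oversize in v_j; last by lia.
  by dec_eval; split=> // /(notQ v_j).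
rewrite mulnS !addSn !add0n; dec_eval => _.
do 2 dec_eval; rewrite hU; last by lia.
dec_eval => [eq_t|/eqP neq_t].
  apply: (dec_le (t := t)); first by lia.
  have lt_j : j < size U by lia.
  by apply: inQ; rewrite eq_t mem_nth.
do 2 dec_eval.
have -> : lb + j.*2 + 2 = lb + j.+1.*2 by lia.
apply: (dec_le _ (IHk _ _ _ _)); rewrite ?(take_nth 0) ?mem_rcons ?inE; try lia.
by rewrite negb_or neq_t.
Qed.

Lemma dec_classes_loop w e tb q a lp le tag t1 t2 h (T : seq nat) bs :
  let te := tb + (size T).*2 in
  let P := start ++ classes_body in
  0 < size T -> letters_at h tb T -> te + 4 < 2 ^ w ->
  all good bs -> sits h a (flatten (map node_code bs)) ->
  e = a + size (flatten (map node_code bs)) -> e + 4 < 2 ^ w ->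
  dec w P (30 * size (flatten (map snd bs)) + 3) (st 16
    [:: e; tb; te; tb + (q %% size T).*2; a; lp; le; tag; t1; t2; 0; 1; 2; 0; 0]
    h)
    (classes_match T q bs).
Proof.
move=> te P T_gt0 hT lt_te + + + lt_e.
elim: bs a q lp le tag t1 t2 => [|nd bs IHbs] a q lp le tag t1 t2.
  move=> _ _ ->; rewrite addn0 muln0 add0n; dec_eval => // _.
  by dec_eval => ?; dec_eval; rewrite /= /dvdn; split=> //; lia.
rewrite /=; case/andP=> /goodP[nd_gt0 nd1] gbs /sits_cat[hnd hbs].
rewrite !size_cat; have sz := size_node_code nd => eE.
set N := size (flatten (map snd bs)) in IHbs *.
apply: (dec_le (t := (9 + (6 * size nd.2 + 2 + (3 + (30 * N + 5))).+2).+1)).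
  by rewrite -/N; lia.
have lt_q : q %% size T < size T by rewrite ltn_pmod.
have lt_nd : 0 < size (node_code nd) by lia.
dec_eval => _.
apply: (dec_parse _ hnd nd_gt0 nd1) => [||t3]; [by code_at_tac | by lia |].
rewrite -[9 + 17]/26; do 2 dec_eval.
rewrite hT // -[nth 0 T _]/(cyc T q).
have := @dec_class w (3 + (30 * N + 5)) (size nd.2) 0 e tb te
  (tb + (q %% size T).*2) a (a + (nd.1 != 0).*2) nd.1 (cyc T q) t2 h nd.2.
rewrite !addn0; apply=> //; try lia.
- exact: sits_letters.
- by rewrite take0.
- by move=> /negPf /= ->.
move=> q_in lp' t2'.
apply: (dec_adv _ T_gt0) => //; [by code_at_tac | by lia |].
rewrite -[3 + 34]/37 addnC; do 2 dec_eval.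
apply: (dec_le (t := 30 * N + 3)); first by lia.
rewrite q_in andTb.
have -> : a + (nd.1 != 0).*2 + (size nd.2).*2 = a + size (node_code nd) by lia.
by apply: IHbs => //; lia.
Qed.

Lemma dec_classes w h (T : node) g (bs : seq node) :
  let x := input T g bs in
  sits h 0 x -> good T -> all good bs -> size x + 4 < 2 ^ w ->
  dec w (start ++ classes_body) (60 * (size T.2 + size (flatten (map snd bs))))
    (st 0 (size x :: nseq 14 0) h) (classes_match T.2 0 bs).
Proof.
move=> x hx gT gbs lt_w; have [T_gt0 _] := goodP gT.
apply: (dec_le (t := 16 + (30 * size (flatten (map snd bs)) + 3))); first by lia.
apply: (dec_start_list hx gT lt_w) => tb t1 te hT hbs ex lt_te.
have := @dec_classes_loop w (size x) tb 0 (te + 2) tb te T.1 t1 0 h T.2 bs.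
by rewrite mod0n addn0; apply=> //; lia.
Qed.

(** * Type [o+]: blocks of equal letters *)

(** The number [j] of extra letters of a [c^+] is chosen nondeterministically; the next lemmas let a
    deterministic reader postpone this choice to the end of each block of items. *)
Fixpoint runs_match (T : seq nat) (q : nat) (bs : seq node) : Prop :=
  if bs is nd :: bs' then
    cyc T q = head 0 nd.2 /\
    exists j, [/\ nd.1 != 0 \/ j = 0,
      forall i, i < j -> cyc T (q.+1 + i) = head 0 nd.2
      & runs_match T (q.+1 + j) bs']
  else size T %| q.

(* The last item read was [c] and it ended at position [q]; when [f] is nonzero
   the current block of [c]'s may be prolonged. *)
Definition runs_match_from T q (f c : nat) bs : Prop :=
  exists j, [/\ f != 0 \/ j = 0, forall i, i < j -> cyc T (q + i) = c
    & runs_match T (q + j) bs].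

Lemma runs_match0 T q c bs : runs_match_from T q 0 c bs <-> runs_match T q bs.
Proof.
split=> [[j [[] // -> _]]|m]; first by rewrite addn0.
by exists 0; split; rewrite ?addn0; auto.
Qed.

Lemma runs_match_flag T q f f' c bs : (f == 0) = (f' == 0) ->
  runs_match_from T q f c bs <-> runs_match_from T q f' c bs.
Proof. by rewrite /runs_match_from => ->. Qed.

(** Extra letters taken before and after an item with the same letter add up, so the required letter
    can be read first and the surplus deferred. *)
Lemma runs_match_same T q f (nd : node) bs :
  runs_match_from T q f (head 0 nd.2) (nd :: bs) <->
  cyc T q = head 0 nd.2 /\
  runs_match_from T q.+1 (if nd.1 == 0 then f else 1) (head 0 nd.2) bs.
Proof.
set c := head 0 nd.2; split.
  case=> j [fj cj [/= cqj [j' [gj' cj' m]]]]; split.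
    by case: j fj cj cqj cj' m => [|j] fj cj; rewrite ?addn0 // -(cj 0) ?addn0.
  exists (j + j'); split; last by rewrite addSn addnA -addSn.
    case: eqP gj' => [_|_ _]; last by left.
    by case=> // ->; rewrite addn0.
  move=> i lt_i; case: (ltnP i.+1 j) => [/cj|le_j]; first by rewrite addnS.
  case: (ltnP i j) => [lt_ij|le_ji].
    have {le_j lt_ij} def_j : j = i.+1 by lia.
    by rewrite addSn -addnS -def_j.
  by apply: etrans (cj' (i - j) _); [congr cyc; lia | lia].
case=> cq [j [+ cj m]]; case: (nd.1 =P 0) => [g0|/eqP g1] fj.
  exists j; split; first by [].
    case=> [|i] lt_i; first by rewrite addn0.
    by rewrite addnS -addSn cj //; lia.
  split; last by exists 0; split; rewrite ?addn0 -?addSn //; right.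
  case: j cj {fj m} => [|j] cj; first by rewrite addn0.
  by rewrite addnS -addSn cj.
exists 0; split=> //=; first by right.
by rewrite addn0; split=> //; exists j; split=> //; left.
Qed.

(** A change of letter forces the surplus: either none is allowed, or the block of [c] in [cyc T]
    must be exhausted. If [cyc T] is constantly [c], both sides are false. *)
Lemma runs_match_diff T q f c j (nd : node) bs :
  head 0 nd.2 <> c -> (forall i, i < j -> cyc T (q + i) = c) ->
  f = 0 /\ j = 0 \/
  f != 0 /\ (cyc T (q + j) <> c \/ forall i, cyc T i = c) ->
  runs_match_from T q f c (nd :: bs) <->
  cyc T (q + j) = head 0 nd.2 /\
  runs_match_from T (q + j).+1 nd.1 (head 0 nd.2) bs.
Proof.
move=> neq_c cj [[-> ->]|[f1 stop]]; first by rewrite runs_match0 addn0.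
split=> [[j' [_ cj' m]]|m]; last by exists j; split=> //; left.
case: (m) => cqj' _; case: (ltngtP j j') => [lt_j|lt_j|-> //]; exfalso.
  case: stop => [|all_c]; first by case; exact: cj'.
  by apply: neq_c; rewrite -cqj'.
by apply: neq_c; rewrite -cqj' cj.
Qed.

(** Blocks are taken in T itself: one that touches the end of T stops at [size T] even if it
    continues cyclically. *)
Definition run_end (T : seq nat) (p r : nat) : Prop :=
  [/\ p < r <= size T, forall i, p <= i < r -> nth 0 T i = nth 0 T p
    & r < size T -> nth 0 T r <> nth 0 T p].

Lemma cyc_run_end T q r i : run_end T (q %% size T) r -> q %% size T + i < r ->
  cyc T (q + i) = cyc T q.
Proof.
case=> /andP[_ le_r] eq_r _ lt_i; rewrite /cyc -modnDml modn_small; last by lia.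
by apply: eq_r; lia.
Qed.

Lemma cyc_run_stop T q r : run_end T (q %% size T) r -> r < size T ->
  cyc T (q + (r - q %% size T)) <> cyc T q.
Proof.
case=> /andP[lt_r _] _ neq_r lt_rT; rewrite /cyc -modnDml subnKC; last by lia.
by rewrite modn_small //; exact: neq_r.
Qed.

(** As [q] is not a multiple of |T|, some surplus is needed and must reach at least the next
    multiple. So the rest of T has to be a single block of [c], and stopping exactly at its end is
    enough. *)
Lemma runs_match_end T q f c r : 0 < size T ->
  run_end T (q %% size T) r -> ~~ (size T %| q) ->
  runs_match_from T q f c [::] <-> [/\ f != 0, cyc T q = c & r = size T].
Proof.
move=> T_gt0 re nd_q; have := re => -[/andP[lt_r le_r] _ _].
have q_eq := divn_eq q (size T); split.
  case=> j [fj cj /= dv_j]; have j_gt0 : 0 < j.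
    by rewrite lt0n; apply: contraNneq nd_q => j0; rewrite j0 addn0 in dv_j.
  have cq : cyc T q = c by rewrite -(cj 0) ?addn0.
  split=> //; first by case: fj => // j0; rewrite j0 in j_gt0.
  have le_j : size T <= q %% size T + j.
    by rewrite dvdn_leq //; [lia | rewrite /dvdn modnDml].
  apply/eqP; rewrite eqn_leq le_r leqNgt; apply/negP => lt_rT.
  by apply: (cyc_run_stop re lt_rT); rewrite cq cj //; lia.
case=> f1 cq def_r; exists (size T - q %% size T); split; first by left.
  by move=> i lt_i; rewrite (cyc_run_end re) //; lia.
rewrite /= {1}q_eq -addnA subnKC ?dvdn_add ?dvdn_mull //; lia.
Qed.

(** [Read 3 3] follows the block end stored in front of the current letter, so the cost does not
    depend on the length of the block. *)
Definition skip_run (o : nat) : program :=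
  [:: Op BAdd 8 3 11; Read 8 8; JumpEq 8 13 (4 + o); Jump (7 + o);
      Read 3 3; JumpLt 3 2 (7 + o); Op BAdd 3 1 10].

(* Instructions 16-26 overwrite the 0 in front of each letter of [T] with the
   position ending the block of equal letters it belongs to; registers 5 and 6
   then hold the position treated and the end of its block. *)
Definition runs_body : program :=
  [:: (* 16 *) Op BAdd 5 2 10; Op BAdd 6 2 10;
      (* 18 *) JumpEq 5 1 27;
      Op BSub 5 5 12; Op BAdd 8 5 11; Read 8 8;
      (* 22 *) JumpEq 8 13 25;
      Op BAdd 6 5 12; Op BAdd 13 8 10;
      (* 25 *) Write 5 6; Jump 18;
      (* 27 *) JumpEq 4 0 68] ++
  (* 28 *) parse 28 ++
  [:: Op BAdd 9 5 11; Read 9 9;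
      (* 39 *) JumpEq 9 13 57; JumpEq 14 10 55] ++
  (* 41 *) skip_run 41 ++ skip_run 48 ++
  [:: (* 55 *) Const 14 0; Op BAdd 13 9 10;
      (* 57 *) Op BAdd 8 3 11; Read 8 8;
      (* 59 *) JumpEq 8 9 61; Halt false] ++
  (* 61 *) adv 61 ++
  [:: (* 64 *) JumpEq 7 10 66; Const 14 1;
      (* 66 *) Op BAdd 4 6 10; Jump 27;
      (* 68 *) JumpEq 3 1 77; JumpEq 14 10 76;
      Op BAdd 8 3 11; Read 8 8;
      (* 72 *) JumpEq 8 13 74; Halt false;
      (* 74 *) Read 8 3; JumpEq 8 2 77;
      (* 76 *) Halt false; Halt true].

Definition run_ends_at (h : nat -> nat) (tb : nat) (T : seq nat) (p : nat) :=
  forall i, p <= i < size T ->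
  exists2 r, h (tb + i.*2) = tb + r.*2 & run_end T i r.

(** The writes hit the cells in front of the letters of T, all below [te <= a], so the letters of T
    and the encoding of B survive. *)
Lemma dec_run_ends w t p e tb tp a bs r tag t1 t2 c f h (T : seq nat) Q :
  let te := tb + (size T).*2 in
  let P := start ++ runs_body in
  te + 4 < 2 ^ w -> te <= a -> p <= size T ->
  (forall i, h i < 2 ^ w) -> letters_at h tb T -> sits h a bs ->
  run_ends_at h tb T p ->
  p < size T /\ run_end T p r /\ c = nth 0 T p \/ p = size T /\ r = size T ->
  (forall h' c' t1 lp le,
    (forall i, h' i < 2 ^ w) -> letters_at h' tb T -> sits h' a bs ->
    run_ends_at h' tb T 0 ->
    dec w P t (st 27
      [:: e; tb; te; tp; a; lp; le; tag; t1; t2; 0; 1; 2; c'; f] h') Q) ->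
  dec w P (9 * p + 1 + t) (st 18
    [:: e; tb; te; tp; a; tb + p.*2; tb + r.*2; tag; t1; t2; 0; 1; 2; c; f] h)
    Q.
Proof.
move=> te P lt_te le_a + + + + + + next.
elim: p r t1 c h => [|p IHp] r t1 c h le_p hw hT hbs hr cP.
  by rewrite muln0 !addSn !add0n; dec_eval => _; exact: next.
rewrite mulnS !addSn !add0n; dec_eval => _.
dec_eval; have -> : tb + p.+1.*2 - 2 = tb + p.*2 by lia.
have lt_c : nth 0 T p < 2 ^ w by rewrite -hT.
dec_eval; dec_eval; rewrite hT //.
have store r' t1' c' : run_end T p r' -> c' = nth 0 T p ->
    dec w P ((9 * p + 1 + t).+2) (st 25
      [:: e; tb; te; tp; a; tb + p.*2; tb + r'.*2; tag; t1'; t2; 0; 1; 2; c'; f]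
      h) Q.
  move=> r'E c'E; have [/andP[_ le_r'] _ _] := r'E.
  do 2 dec_eval; apply: IHp; first by lia.
  - by move=> i; rewrite /upd; case: eqP => // _; lia.
  - by move=> i lt_i; rewrite /upd ifN ?hT //; apply/eqP; lia.
  - by move=> i lt_i; rewrite /upd ifN ?hbs //; apply/eqP; lia.
  - move=> i /andP[le_i lt_i]; rewrite /upd; case: (i =P p) => [->|neq_i].
      by rewrite eqxx; exists r'.
    by rewrite ifN; [apply: hr; lia | apply/eqP; lia].
  by left; split=> //; lia.
dec_eval => [eq_c|neq_c].
  apply: dec_le (store r _ _ _ _) => //; first by lia.
  case: cP => [[lt_p [[/andP[lt_r le_r] eq_r neq_r] cE]]|[pE ->]].
    split=> [|i /andP[le_i lt_i]|lt_rT]; first by lia.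
      case: (ltngtP p i) le_i => // [lt_pi _|<- //].
      by rewrite eq_r ?lt_pi // eq_c.
    by rewrite eq_c cE; exact: neq_r.
  (* For the last letter of T, [c] is an arbitrary initial value; should it equal that letter, the
     initial [r = size T] is correct anyway. *)
  rewrite -pE; split=> [|i /andP[le_i lt_i]|]; [lia | | lia].
  by have -> : i = p by lia.
do 2 dec_eval.
have -> : tb + p.*2 + 2 = tb + p.+1.*2 by lia.
apply: dec_le (store p.+1 _ _ _ _) => //.
split=> [|i /andP[le_i lt_i]|lt_p]; first by lia.
  by have -> : i = p by lia.
by case: cP => [[_ [_ <-]] eq_n|[]]; [case: neq_c | lia].
Qed.

(** A skip may stop at the end of T in the middle of a cyclic block. The last fact given to the
    continuation concerns the second skip: started at a multiple of |T|, it reaches a letter other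
    than [c] unless T has no other letter. *)
Lemma dec_skip_run w P o t q e tb te a lp le tag t1 t2 c f h (T : seq nat) Q :
  te = tb + (size T).*2 -> te + 4 < 2 ^ w -> 0 < size T ->
  code_at P o (skip_run o) -> letters_at h tb T -> run_ends_at h tb T 0 ->
  (forall j t1, (forall i, i < j -> cyc T (q + i) = c) ->
    cyc T (q + j) <> c \/ size T %| q + j ->
    (size T %| q -> cyc T (q + j) <> c \/ forall i, cyc T i = c) ->
    dec w P t (st (7 + o) [:: e; tb; te; tb + ((q + j) %% size T).*2; a; lp; le;
      tag; t1; t2; 0; 1; 2; c; f] h) Q) ->
  dec w P (7 + t) (st o [:: e; tb; te; tb + (q %% size T).*2; a; lp; le; tag;
    t1; t2; 0; 1; 2; c; f] h) Q.
Proof.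
move=> teE lt_te T_gt0 oP hT hr next; rewrite !addSn !add0n in next *.
have lt_q : q %% size T < size T by rewrite ltn_pmod.
dec_step dec_add oP 0; first by lia.
dec_step dec_read oP 1.
rewrite hT // -[nth 0 T _]/(cyc T q).
dec_step dec_jeq oP 2 => [cq|ncq]; last first.
  dec_step dec_jump oP 3; apply: (dec_le (t := t)); first by lia.
  rewrite -[q]addn0; apply: next => // [|_]; by left; rewrite addn0.
have [|r hr_q re] := hr (q %% size T); first by lia.
have := re => -[/andP[lt_r le_r] eq_r _].
dec_step dec_read oP 4; rewrite hr_q.
set j := r - q %% size T; have r_eq : r = q %% size T + j by rewrite /j; lia.
have cj i : i < j -> cyc T (q + i) = c.
  by move=> lt_i; rewrite (cyc_run_end re) //; lia.
have mod_r : (q + j) %% size T = r %% size T by rewrite -modnDml -r_eq.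
dec_step dec_jlt oP 5 => [lt_rT|le_rT].
  apply: (dec_le (t := t)); first by lia.
  have lt_r_size : r < size T by lia.
  have neq_c : cyc T (q + j) <> c by rewrite -cq; exact: cyc_run_stop.
  have := next j (cyc T q) cj (or_introl neq_c) (fun=> or_introl neq_c).
  by rewrite mod_r modn_small.
have def_r : r = size T by lia.
dec_step dec_add oP 6; first by lia.
have q_j : (q + j) %% size T = 0 by rewrite mod_r def_r modnn.
have := next j (cyc T q) cj (or_intror (introT eqP q_j)); rewrite q_j.
(* A block that starts at 0 and ends at [size T] is all of T. *)
move=> reach; apply: (dec_le (leqnSn t)); apply: reach => /eqP q0; right=> i.
by rewrite -cq /cyc -(eq_r (i %% size T)) // q0 leq0n def_r ltn_pmod.
Qed.
Arguments dec_skip_run {w P o t q e tb te a lp le tag t1 t2 c f h T Q}.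

(** Each child costs a bounded number of instructions, however long the blocks of T are, so the time
    is linear in the size of B alone. *)
Lemma dec_runs_loop w e tb q a lp le tag t1 t2 c f h (T : seq nat) bs :
  let te := tb + (size T).*2 in
  let P := start ++ runs_body in
  0 < size T -> letters_at h tb T -> te + 4 < 2 ^ w -> (forall i, h i < 2 ^ w) ->
  run_ends_at h tb T 0 ->
  all good bs -> sits h a (flatten (map node_code bs)) ->
  e = a + size (flatten (map node_code bs)) -> e + 4 < 2 ^ w ->
  dec w P (50 * size (flatten (map snd bs)) + 9) (st 27
    [:: e; tb; te; tb + (q %% size T).*2; a; lp; le; tag; t1; t2; 0; 1; 2; c; f]
    h)
    (runs_match_from T q f c bs).
Proof.
move=> te P T_gt0 hT lt_te hw hr + + + lt_e.
have lt_q q' : q' %% size T < size T by rewrite ltn_pmod.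
elim: bs a q lp le tag t1 t2 c f => [|nd bs IHbs] a q lp le tag t1 t2 c f.
  move=> _ _ ->; rewrite addn0 muln0 add0n; have lt_qT := lt_q q.
  dec_eval => // _.
  dec_eval => [q0|qn0].
    by dec_eval; split=> // _; exists 0; split; rewrite /= ?addn0 /dvdn; lia || auto.
  have nd_q : ~~ (size T %| q) by rewrite /dvdn; lia.
  have [|r hr_q re] := hr (q %% size T); first by lia.
  apply: (dec_iff (iff_sym (runs_match_end f c T_gt0 re nd_q))).
  dec_eval => [f0|/eqP f1]; first by dec_eval; split=> // -[]; rewrite f0.
  do 2 dec_eval; rewrite hT // -[nth 0 T _]/(cyc T q).
  dec_eval => [cq|ncq]; last by dec_eval; split=> // -[].
  dec_eval; rewrite hr_q.
  dec_eval => [rE|rE]; dec_eval; split=> //; first by split=> //; lia.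
  by case=> _ _ rT; case: rE; rewrite rT.
rewrite /=; case/andP=> /goodP[nd_gt0 nd1] gbs /sits_cat[hnd hbs].
rewrite !size_cat; have sz := size_node_code nd => eE.
set N := size (flatten (map snd bs)) in IHbs *.
apply: (dec_le (t := (9 + (50 * N + 41)).+1)); first by rewrite -/N; lia.
have lt_nd : 0 < size (node_code nd) by lia.
dec_eval => _.
apply: (dec_parse _ hnd nd_gt0 nd1) => [||t3]; [by code_at_tac | by lia |].
rewrite -[9 + 28]/37; apply: (dec_le (t := (7 + (7 + (50 * N + 21))).+4)).
  by lia.
do 2 dec_eval; set x := head 0 nd.2.
have -> : h (a + (nd.1 != 0).*2 + 1) = x.
  by rewrite /x -nth0 -(sits_letters hnd) // addn0.
have x_lt : x < 2 ^ w by rewrite /x -nth0 -(sits_letters hnd).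
(* Shared by the items that prolong the current block and those that open a new one: by then
   register 13 holds [x] in both cases. *)
have consume q' t1' f' : dec w P (50 * N + 19) (st 57
    [:: e; tb; te; tb + (q' %% size T).*2; a; a + (nd.1 != 0).*2;
      a + (nd.1 != 0).*2 + (size nd.2).*2; nd.1; t1'; x; 0; 1; 2; x; f'] h)
    (cyc T q' = x /\
     runs_match_from T q'.+1 (if nd.1 == 0 then f' else 1) x bs).
  have lt_q'T := lt_q q'.
  apply: (dec_le (t := (3 + (50 * N + 9).+4).+3)); first by lia.
  do 2 dec_eval; rewrite hT // -[nth 0 T _]/(cyc T q').
  dec_eval => [cq|ncq]; last by dec_eval; split=> // -[].
  apply: (dec_adv _ T_gt0) => //; [by code_at_tac | by lia |].
  rewrite -[3 + 61]/64.
  suff next f'' : f'' = (if nd.1 == 0 then f' else 1) ->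
      dec w P (50 * N + 9).+2 (st 66
    [:: e; tb; te; tb + (q'.+1 %% size T).*2; a; a + (nd.1 != 0).*2;
      a + (nd.1 != 0).*2 + (size nd.2).*2; nd.1; cyc T q'; x; 0; 1; 2; x; f'']
    h) (cyc T q' = x /\
      runs_match_from T q'.+1 (if nd.1 == 0 then f' else 1) x bs).
    dec_eval => [g0|/eqP g1].
      by apply: dec_le (next f' _); [lia | rewrite g0].
    by dec_eval; apply: next; rewrite (negPf g1).
  move=> ->; do 2 dec_eval.
  have -> : a + (nd.1 != 0).*2 + (size nd.2).*2 = a + size (node_code nd).
    by lia.
  by apply: dec_iff (IHbs _ _ _ _ _ _ _ _ _ _ _ _); [tauto | | | lia].
dec_eval => [x_c|neq_c].
  rewrite -x_c; apply: (dec_le _ (dec_iff _ (consume q _ f))); first by lia.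
  by apply: iff_sym; exact: runs_match_same.
(* Address 55 opens a new block and clears the flag; both uses justify the position [q'] by
   [runs_match_diff]. *)
have start_run q' t1' t' : 50 * N + 21 <= t' ->
    (runs_match_from T q f c (nd :: bs) <->
      cyc T q' = x /\ runs_match_from T q'.+1 nd.1 x bs) ->
    dec w P t' (st 55 [:: e; tb; te; tb + (q' %% size T).*2; a;
      a + (nd.1 != 0).*2; a + (nd.1 != 0).*2 + (size nd.2).*2; nd.1; t1'; x;
      0; 1; 2; c; f] h) (runs_match_from T q f c (nd :: bs)).
  move=> le_t' mE; apply: (dec_le le_t'); apply: (dec_iff (iff_sym mE)).
  have -> : 50 * N + 21 = (50 * N + 19).+2 by lia.
  do 2 dec_eval; apply: dec_iff (consume q' t1' 0).
  have flag : (if nd.1 == 0 then 0 else 1) == 0 = (nd.1 == 0) by case: (nd.1 == 0).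
  by have := runs_match_flag T q'.+1 x bs flag; tauto.
have {}neq_c : x <> c by [].
dec_eval => [f0|/eqP f1].
  apply: start_run; first by lia.
  rewrite -[q in X in _ <-> X]addn0; apply: runs_match_diff => //; left.
  by rewrite f0.
apply: (dec_skip_run _ lt_te T_gt0 _ hT hr) => // [|j1 t4 cj1 stop1 per1].
  by code_at_tac.
apply: (dec_skip_run _ lt_te T_gt0 _ hT hr) => // [|j2 t5 cj2 stop2 per2].
  by code_at_tac.
rewrite -[7 + 48]/55 -addnA in cj2 stop2 per2 *.
apply: start_run; first by lia.
apply: runs_match_diff => // [i lt_i|].
  case: (ltnP i j1) => [/cj1 //|le_i].
  by apply: etrans (cj2 (i - j1) _); [congr cyc; lia | lia].
(* If the first skip stopped at a letter other than [c], the second one skips nothing; otherwise it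
   started at a multiple of |T|. *)
right; split=> //; case: stop1 => [neq1|/per2 //]; left.
case: j2 cj2 {stop2 per2} => [|j2] cj2; first by rewrite addn0.
by case: neq1; rewrite -[q + j1]addn0 cj2.
Qed.

Lemma dec_runs w h (T : node) g (bs : seq node) :
  let x := input T g bs in
  sits h 0 x -> (forall i, h i < 2 ^ w) ->
  good T -> all good bs -> size x + 4 < 2 ^ w ->
  dec w (start ++ runs_body) (90 * (size T.2 + size (flatten (map snd bs))))
    (st 0 (size x :: nseq 14 0) h) (runs_match T.2 0 bs).
Proof.
move=> x hx hw gT gbs lt_w; have [T_gt0 _] := goodP gT.
set N := size (flatten (map snd bs)).
apply: (dec_le (t := 16 + (9 * size T.2 + 1 + (50 * N + 9)).+2)); first by lia.
apply: (dec_start_list hx gT lt_w) => tb t1 te hT hbs ex lt_te.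
apply: (dec_iff (runs_match0 T.2 0 0 bs)); do 2 dec_eval.
apply: (@dec_run_ends w (50 * N + 9) (size T.2) (size x) tb tb (te + 2)
  (flatten (map node_code bs)) (size T.2)) => //; try lia.
- by move=> i; lia.
move=> h' c' t1' lp le hw' hT' hbs' hr'.
(* Flag 0 forbids prolongation, so the letter left in register 13 by the backward pass cannot affect
   the predicate. *)
apply: (dec_iff (iff_trans (runs_match0 T.2 0 c' bs)
                           (iff_sym (runs_match0 T.2 0 0 bs)))).
have := @dec_runs_loop w (size x) tb 0 (te + 2) lp le T.1 t1' 0 c' 0 h' T.2 bs.
by rewrite mod0n addn0; apply=> //; lia.
Qed.

(** * From positions in [cyc T] to languages *)

Definition fits (T : seq nat) (q : nat) (u : seq nat) : Prop :=
  forall i, i < size u -> nth 0 u i = cyc T (q + i).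

Lemma fits_cat T q u v :
  fits T q (u ++ v) <-> fits T q u /\ fits T (q + size u) v.
Proof.
split=> [fuv|[fu fv] i].
  split=> i lt_i; first by rewrite -fuv ?nth_cat ?lt_i // size_cat; lia.
  rewrite -addnA -fuv ?nth_cat ?size_cat; last by lia.
  by rewrite ltnNge leq_addr addKn.
rewrite size_cat nth_cat => lt_i; case: ltnP => [/fu //|le_i].
by rewrite fv; [congr cyc; lia | lia].
Qed.

Lemma fits0_power T u : 0 < size T ->
  (fits T 0 u /\ size T %| size u) <-> exists k, u = flatten (nseq k T).
Proof.
move=> T_gt0; split=> [[fu /dvdnP[k szu]]|[k ->]].
  exists k; rewrite flatten_nseq_cyc -szu -[LHS](mkseq_nth 0).
  by apply/eq_in_map => i; rewrite mem_iota => /andP[_ /fu].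
rewrite flatten_nseq_cyc; split=> [i|]; rewrite size_mkseq ?dvdn_mull //.
by move=> lt_i; rewrite nth_mkseq.
Qed.

Lemma is_powerP T u : 0 < size T ->
  is_power T u <-> exists k, u = flatten (nseq k T).
Proof.
move=> T_gt0; rewrite /is_power; split=> [/andP[/dvdnP[k ->] /eqP->]|[k ->]].
  by exists k; rewrite flatten_nseq_cyc.
by rewrite flatten_nseq_cyc size_mkseq dvdn_mull ?eqxx.
Qed.

Lemma cat_nseqC (T U : seq nat) k : T ++ U = U ++ T ->
  flatten (nseq k T) ++ U = U ++ flatten (nseq k T).
Proof.
move=> TU; elim: k => [|k IHk] /=; first by rewrite cats0.
by rewrite -catA IHk !catA TU.
Qed.

(** If T and U commute, so do their powers with exponents |U| and |T|; these have equal length,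
    hence coincide. Conversely a common power gives [cyc T = cyc U] pointwise, and both products are
    the prefix of length |T| + |U| of this word. *)
Lemma common_power (T U : seq nat) : 0 < size T -> 0 < size U ->
  T ++ U = U ++ T <->
  exists k, exists2 j, 0 < j & flatten (nseq k T) = flatten (nseq j U).
Proof.
move=> T_gt0 U_gt0; split=> [TU|[k [j j_gt0 eqTU]]].
  exists (size U), (size T) => //; apply/eqP.
  have := cat_nseqC (size U) TU => /esym/(cat_nseqC (size T))/eqP.
  by rewrite eqseq_cat => [/andP[]|]; rewrite ?flatten_nseq_cyc ?size_mkseq; lia.
rewrite !flatten_nseq_cyc in eqTU.
have eq_sz : k * size T = j * size U.
  by rewrite -(size_mkseq (cyc T) (k * _)) eqTU size_mkseq.
(* The length of the common power is a multiple of both periods, so any index may be reduced modulo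
   it. *)
have eq_cyc i : cyc T i = cyc U i.
  have L_gt0 : 0 < j * size U by rewrite muln_gt0 j_gt0.
  have := congr1 (fun s => nth 0 s (i %% (j * size U))) eqTU.
  rewrite !nth_mkseq ?eq_sz ?ltn_pmod // /cyc.
  by rewrite -{1}eq_sz !modn_dvdm ?dvdn_mull.
have catE X Y : 0 < size X -> (forall i, cyc X i = cyc Y i) ->
    X ++ Y = mkseq (cyc X) (size X + size Y).
  move=> X_gt0 eqXY; apply: (@eq_from_nth _ 0) => [|i].
    by rewrite size_cat size_mkseq.
  rewrite size_cat => lt_i; rewrite nth_mkseq // nth_cat /cyc.
  case: ltnP => [lt_iX|le_i]; first by rewrite modn_small.
  rewrite -{2}(subnK le_i) modnDr -/(cyc X _) eqXY /cyc modn_small //; lia.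
rewrite !catE // addnC; apply: eq_map; exact: eq_cyc.
Qed.

Lemma classes_matchP T q bs : all (wf_node OAlt) bs ->
  classes_match T q bs <-> exists u,
    [/\ foldr lcat leps (map lang (map (node_regex OAlt) bs)) u, fits T q u
      & size T %| q + size u].
Proof.
elim: bs q => [|nd bs IHbs] q /=.
  move=> _; split=> [dv|[u [-> _]]]; last by rewrite addn0.
  by exists [::]; rewrite addn0; split.
case/andP=> wf_nd /IHbs{}IHbs; split.
  case/andP=> c_in /IHbs[u [langu fu dv]]; exists ([:: cyc T q] ++ u).
  split; [|apply/fits_cat; rewrite addn1; split=> //|].
  - exists [:: cyc T q], u; split=> //; split=> //.
    by apply/lang_alt_node => //; exists (cyc T q).
  - by case=> // _; rewrite addn0.
  - by rewrite /= addnS -addSn.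
case=> _ [[u1 [u [-> [/(lang_alt_node _ wf_nd)[c c_in ->] langu]]]]].
case/fits_cat; rewrite addn1 => fc fu dv.
rewrite -[cyc T q]/(cyc T q) -[q in cyc T q]addn0 -(fc 0) // c_in /=.
by apply/IHbs; exists u; split=> //; rewrite addSn -addnS.
Qed.

Lemma runs_matchP T q bs : all (wf_node OPlus) bs ->
  runs_match T q bs <-> exists u,
    [/\ foldr lcat leps (map lang (map (node_regex OPlus) bs)) u, fits T q u
      & size T %| q + size u].
Proof.
elim: bs q => [|nd bs IHbs] q /=.
  move=> _; split=> [dv|[u [-> _]]]; last by rewrite addn0.
  by exists [::]; rewrite addn0; split.
case/andP=> wf_nd /IHbs{}IHbs; split.
  case=> cq [j [gj cj /IHbs[u [langu fu dv]]]].
  exists (nseq j.+1 (head 0 nd.2) ++ u); split; [|apply/fits_cat; split|].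
  - exists (nseq j.+1 (head 0 nd.2)), u; split=> //; split=> //.
    by apply/lang_plus_node => //; exists j.+1 => //=; case: gj => ->; rewrite ?orbT.
  - move=> i; rewrite size_nseq => lt_i; rewrite nth_nseq lt_i.
    by case: i lt_i => [|i] lt_i; rewrite ?addn0 // addnS -addSn cj.
  - by rewrite size_nseq addnS -addSn.
  - by rewrite size_cat size_nseq addnA addnS -addSn.
case=> _ [[u1 [u [-> [/(lang_plus_node _ wf_nd)[[|j] //= gj ->] langu]]]]].
case/(fits_cat _ _ (_ :: _)); rewrite /= size_nseq addnS -addSn => fc fu dv.
split; first by have := fc 0 isT; rewrite addn0.
exists j; split.
- by case/orP: gj => [|/eqP[->]]; [left | right].
- move=> i lt_i; have := fc i.+1; rewrite /= size_nseq nth_nseq lt_i addnS -addSn.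
  by move=> /(_ lt_i).
- apply/IHbs; exists u; split=> //; move: dv.
  by rewrite size_cat size_nseq; congr (_ %| _); lia.
Qed.

Lemma lalt_nodes bs u : all (wf_node OCat) bs ->
  foldr lalt lempty (map lang (map (node_regex OCat) bs)) u <->
  exists2 nd, nd \in bs & u = nd.2.
Proof.
elim: bs => [|nd bs IHbs] /=; first by split=> // -[].
case/andP=> wf_nd /IHbs{}IHbs; split.
  case=> [/(lang_cat_node _ wf_nd)->|/IHbs[nd1 nd1_in ->]].
    by exists nd; rewrite ?mem_head.
  by exists nd1; rewrite ?inE ?nd1_in ?orbT.
case=> nd1; rewrite inE => /orP[/eqP->|nd1_in] uE.
  by left; apply/lang_cat_node.
by right; apply/IHbs; exists nd1.
Qed.

(** * Input size, word length and assembly *)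

Lemma wf_good o nd : wf_node o nd -> good nd.
Proof.
case/and3P=> nd_gt0 _ /implyP nd1; rewrite /good nd_gt0 /=.
by apply/implyP => nd10; apply: nd1; rewrite nd10.
Qed.

(** A child with s >= 1 letters takes at most 2 + 2s <= 4s cells. *)
Lemma size_node_codes bs : all good bs ->
  size (flatten (map node_code bs)) <= 4 * size (flatten (map snd bs)).
Proof.
elim: bs => //= nd bs IHbs /andP[/goodP[nd_gt0 _] /IHbs].
by rewrite !size_cat size_node_code; case: (nd.1 != 0); lia.
Qed.

Lemma node_code_bound (o : rop) nd v : wf_node o nd -> 4 < v -> size nd.2 < v ->
  all (fun c => c < v) nd.2 -> all (fun c => c < v) (node_code nd).
Proof.
case/and3P=> nd_gt0 tag _ v4 lt_v lt_nd.
have lt_p : all (fun c => c < v) (pairs nd.2).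
  elim: (nd.2) lt_nd => //= c s IHs /andP[-> /IHs]; rewrite -/(pairs s) => ->.
  by rewrite !andbT; lia.
rewrite /node_code; case: eqP tag => // _ /= /eqP->; rewrite lt_v lt_p !andbT.
by case: (o); apply: leq_trans v4.
Qed.

Lemma decides_init w P x t Q : size x < 2 ^ w -> all (fun c => c < 2 ^ w) x ->
  (forall h, (forall i, h i < 2 ^ w) -> sits h 0 x ->
    dec w P t (st 0 (size x :: nseq 14 0) h) Q) ->
  decides_within w P x t Q.
Proof.
move=> lt_w lt_x next; have w_gt0 : 0 < 2 ^ w by rewrite expn_gt0.
have: dec w P t (st 0 (size x :: nseq 14 0) (fun i => nth 0 x i %% 2 ^ w)) Q.
  apply: next => i; first by rewrite ltn_pmod.
  by move=> lt_i; rewrite add0n modn_small //; exact: (all_nthP 0 lt_x).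
rewrite /decides_within /init modn_small //.
suff -> : upd (fun=> 0) 0 (size x) = nth 0 (size x :: nseq 14 0) by [].
apply: functional_extensionality => -[|i]; rewrite /upd //= -[0 :: _]/(nseq 14 0).
by rewrite nth_nseq if_same.
Qed.

Definition decided (t : rop * rop) (d : nat) : Prop :=
  exists (P : program) (C k : nat),
    forall (A B : regex) (m n sigma w : nat),
      homogeneous (OStar, OCat) A -> rsize A = m ->
      homogeneous t B -> rsize B = n ->
      all (fun c => c < sigma) (leaves A ++ leaves B) ->
      sigma <= (m + n) ^ d ->
      (m + n) ^ k <= 2 ^ w ->
      decides_within w P (encode A ++ encode B) (C * (m + n))
        (exists s : seq nat, lang A s /\ lang B s).

(** Separates the machine, which decides a combinatorial condition [Q], from the proof that [Q]
    expresses a common word; encodings and word length are treated once here. *)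
Lemma decided_by (t : rop * rop) d (P : program) (Q : seq nat -> seq node -> Prop) :
  (forall w h (T : node) bs, let x := input T (rop_code t.1) bs in
    sits h 0 x -> (forall i, h i < 2 ^ w) -> good T -> all good bs ->
    size x + 4 < 2 ^ w -> (t.1 = OPlus -> size bs = 1) ->
    dec w P (90 * (size T.2 + size (flatten (map snd bs))))
      (st 0 (size x :: nseq 14 0) h) (Q T.2 bs)) ->
  (forall (T : seq nat) bs B, 0 < size T -> all (wf_node t.2) bs ->
    label B = Some t.1 -> children B = map (node_regex t.2) bs ->
    Q T bs <-> exists s, (exists k, s = flatten (nseq k T)) /\ lang B s) ->
  decided t d.
Proof.
(* The power [d] accounts for the alphabet. As m + n >= 2, the power 6 gives
   [32 * (m + n) <= 2 ^ w], which leaves room for all addresses, the input having at most 6 + 4(m +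
   n) cells. *)
move=> decP QP; exists P, 90, (d + 6) => A B m n sigma w.
case/lang_star=> T wfT [leavesA codeA langA] szA homB szB.
have [bs [childB bs_gt0 wfbs leavesB codeB]] := homogeneousP homB.
case/andP: homB => /andP[/eqP labB _] _.
rewrite codeA codeB leavesA leavesB => lt_sigma le_sigma le_w.
have szT : size T.2 = m by rewrite -leavesA.
have szbs : size (flatten (map snd bs)) = n by rewrite -leavesB.
rewrite -[_ ++ _]/(input T (rop_code t.1) bs).
have gT := wf_good wfT; have [T_gt0 _] := goodP gT.
have gbs : all good bs by apply: sub_all wfbs => nd; exact: wf_good.
have n_gt0 : 0 < n.
  rewrite -szbs; case: (bs) gbs bs_gt0 => //= nd bs' /andP[/goodP[nd_gt0 _] _] _.
  by rewrite size_cat ltn_addr.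
have N2 : 1 < m + n by lia.
have d_gt0 : 0 < (m + n) ^ d by rewrite expn_gt0; lia.
have N6_gt0 : 0 < (m + n) ^ 6 by rewrite expn_gt0; lia.
have N5 : 2 ^ 5 <= (m + n) ^ 5 by rewrite leq_exp2r.
have sigma_w : sigma <= 2 ^ w.
  apply: leq_trans le_sigma (leq_trans _ le_w).
  by rewrite expnD leq_pmulr.
have N_w : 32 * (m + n) <= 2 ^ w.
  apply: leq_trans le_w; rewrite expnD; apply: leq_trans (leq_pmull _ d_gt0).
  by rewrite (expnSr _ 5) leq_mul2r N5 orbT.
have sz_x : size (input T (rop_code t.1) bs) <= 6 + 4 * (m + n).
  rewrite /input !size_cat size_node_code szT -szbs /=.
  by have := size_node_codes gbs; case: (T.1 != 0); lia.
have code_w o nd : wf_node o nd -> all (fun c => c < sigma) nd.2 ->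
    size nd.2 <= m + n -> all (fun c => c < 2 ^ w) (node_code nd).
  move=> wf_nd lt_nd le_nd; apply: node_code_bound wf_nd _ _ _; try lia.
  by apply: sub_all lt_nd => c lt_c; exact: leq_trans sigma_w.
apply: decides_init => [||h hw hx]; first by lia.
  move: lt_sigma; rewrite all_cat => /andP[lt_T lt_bs].
  rewrite /input !all_cat (code_w _ _ wfT lt_T) /=; last by lia.
  have -> : rop_code t.1 < 2 ^ w by case: (t.1) => /=; lia.
  have le_bs : size bs <= n.
    rewrite -szbs; elim: (bs) gbs => //= nd bs' IH /andP[/goodP[nd_gt0 _] /IH].
    by rewrite size_cat; lia.
  have le_n : size (flatten (map snd bs)) <= m + n by lia.
  have [-> -> ->] : [/\ 4 < 2 ^ w, 1 < 2 ^ w & size bs < 2 ^ w] by split; lia.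
  rewrite /=; elim: (bs) wfbs lt_bs le_n => //= nd bs' IH /andP[wf_nd wf_bs'].
  rewrite !all_cat size_cat => /andP[lt_nd lt_bs'] le_n.
  by rewrite (code_w _ _ wf_nd lt_nd) ?IH //; lia.
rewrite -szT -szbs; apply: dec_iff (decP w h T bs hx hw gT gbs _ _).
- by rewrite (QP _ _ B) //; split=> -[s [As Bs]]; exists s; split=> //; apply/langA.
- by lia.
- by move=> oP; move: labB childB; rewrite oP; case: (B) => // r _ /(congr1 size);
    rewrite size_map.
Qed.

Lemma match_powers (T : seq nat) (L : language) : 0 < size T ->
  (exists u, [/\ L u, fits T 0 u & size T %| 0 + size u]) <->
  exists s, (exists k, s = flatten (nseq k T)) /\ L s.
Proof.
move=> T_gt0; split=> [[u [Lu fu dv]]|[s [/(fits0_power _ T_gt0)[fs dv] Ls]]].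
  by exists u; split=> //; apply/fits0_power.
by exists s; split.
Qed.

Lemma decided_classes d : decided (OCat, OAlt) d.
Proof.
apply: (@decided_by _ d (start ++ classes_body)
    (fun T bs => classes_match T 0 bs)).
  move=> w h T bs x hx _ gT gbs lt_w _.
  by apply: dec_le (dec_classes hx gT gbs lt_w); lia.
move=> T bs B T_gt0 wfbs; case: B => // l _ /= ->.
by rewrite (classes_matchP _ _ wfbs); exact: match_powers.
Qed.

Lemma decided_runs d : decided (OCat, OPlus) d.
Proof.
apply: (@decided_by _ d (start ++ runs_body) (fun T bs => runs_match T 0 bs)).
  by move=> w h T bs x hx hw gT gbs lt_w _; exact: dec_runs.
move=> T bs B T_gt0 wfbs; case: B => // l _ /= ->.
by rewrite (runs_matchP _ _ wfbs); exact: match_powers.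
Qed.

Lemma decided_alt d : decided (OAlt, OCat) d.
Proof.
apply: (@decided_by _ d (start ++ alt_body)
  (fun T bs => has (fun nd => is_power T nd.2) bs)).
  move=> w h T bs x hx _ gT gbs lt_w _.
  by apply: dec_le (dec_alt hx gT gbs lt_w); lia.
move=> T bs B T_gt0 wfbs; case: B => // l _ /= ->.
split=> [/hasP[nd nd_in /(is_powerP _ T_gt0) powT]|[s [powT]]].
  by exists nd.2; split=> //; apply/(lalt_nodes _ wfbs); exists nd.
case/(lalt_nodes _ wfbs)=> nd nd_in sE; apply/hasP; exists nd => //.
by apply/is_powerP; rewrite // -sE.
Qed.

Lemma decided_plus d : decided (OPlus, OCat) d.
Proof.
apply: (@decided_by _ d (start ++ plus_body)
  (* The root of B has a single child, so [U] is its string. *)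
  (fun T bs => let U := flatten (map snd bs) in T ++ U = U ++ T)).
  move=> w h T [|U [|V bs]] x hx _ gT gbs lt_w /(_ erefl) // _.
  rewrite /= cats0; apply: dec_le (dec_plus hx gT _ lt_w); first by lia.
  by case/andP: gbs.
move=> T bs B T_gt0 wfbs; case: B => // r _ /= chB.
case: bs wfbs chB => [|U [|V bs]] //= /andP[wfU _] [->]; rewrite cats0.
have [U_gt0 _] := goodP (wf_good wfU); rewrite (common_power T_gt0 U_gt0).
have powE k u : lpow (lang (node_regex OCat U)) k u <-> u = flatten (nseq k U.2).
  by apply: lpow1 => v; exact: lang_cat_node.
split=> [[k [j j_gt0 eqTU]]|[s [[k ->] [j j_gt0 /powE eqTU]]]].
  exists (flatten (nseq k T)); split; first by exists k.
  by exists j => //; apply/powE.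
by exists k, j.
Qed.

Lemma decided_star d : decided (OStar, OCat) d.
Proof.
exists [:: Halt true], 1, 0 => A B m n sigma w.
case/lang_star=> T wfT [leavesA _ langA] szA.
case/lang_star=> U _ [_ _ langB] szB _ _ _.
have [T_gt0 _] := goodP (wf_good wfT).
(* The final [Halt] counts as a step, so the time bound must be positive. *)
have: 0 < 1 * (m + n) by rewrite -szA /rsize leavesA; lia.
case: (1 * _) => // t _; exists true; split=> //; split=> // _.
by exists [::]; split; [apply/langA | apply/langB]; exists 0.
Qed.

Theorem theorem5 (t : rop * rop)
    (ht : t \in [:: (OCat, OAlt); (OCat, OPlus); (OAlt, OCat);
                    (OPlus, OCat); (OStar, OCat)])
    (d : nat) :
  exists (P : program) (C k : nat),
    forall (A B : regex) (m n sigma w : nat),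
      homogeneous (OStar, OCat) A -> rsize A = m ->
      homogeneous t B -> rsize B = n ->
      all (fun c => c < sigma) (leaves A ++ leaves B) ->
      sigma <= (m + n) ^ d ->
      (m + n) ^ k <= 2 ^ w ->
      decides_within w P (encode A ++ encode B) (C * (m + n))
        (exists s : seq nat, lang A s /\ lang B s).
Proof.
move: ht; rewrite !inE => /or4P[/eqP->|/eqP->|/eqP->|/orP[]/eqP->].
- exact: decided_classes.
- exact: decided_runs.
- exact: decided_alt.
- exact: decided_plus.
- exact: decided_star.
Qed.
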